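(* Let $\Gamma=(V,E)$ be the graph given by the $1$-skeleton (vertices and edges) of a regular polytope in $\mathbb{R}^N$ ($N\ge2$; convex or star, in the sense of Coxeter's classification via Schläfli symbols), and let $P:\mathbb{R}^N\to\mathbb{C}$ be any orthogonal projection. Then $\phi=P|_V:V\to\mathbb{C}$ satisfies equation (1) at every vertex with $\gamma$ a (real) constant.
   Context: An orthogonal projection $P:\mathbb{R}^N\to\mathbb{C}$ is a map $P(\vec y)=\langle\vec e_1,\vec y\rangle+i\langle\vec e_2,\vec y\rangle$ for some orthonormal pair $\vec e_1,\vec e_2\in\mathbb{R}^N$. Equation (1) at a vertex $x$ of degree $n(x)$ for $\phi:V\to\mathbb{C}$, $\gamma:V\to\mathbb{R}$: $\frac{\gamma(x)}{n(x)}\big(\sum_{y\sim x}(\phi(y)-\phi(x))\big)^2=\sum_{y\sim x}(\phi(x)-\phi(y))^2$. *)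

(* Defs.v *)
From HB Require Import structures.
From mathcomp Require Import all_boot all_order all_algebra.
Set Implicit Arguments. Unset Strict Implicit. Unset Printing Implicit Defensive.
Import Order.TTheory GRing.Theory Num.Theory.
Local Open Scope ring_scope.

(* The ambient field: C is a numeric closed field (e.g. the complex numbers);
   R^N is realised as the row vectors of 'rV[C]_N with real entries, so that an
   orthogonal projection R^N -> C can be written y |-> <e1,y> + i <e2,y>. *)

Definition realv (C : numClosedFieldType) (N : nat) (v : 'rV[C]_N) : Prop :=
  forall i, v 0 i \is Num.real.

Definition realmx (C : numClosedFieldType) (N : nat) (Q : 'M[C]_N) : Prop :=
  forall i j, Q i j \is Num.real.

Definition dotv (C : numClosedFieldType) (N : nat) (u v : 'rV[C]_N) : C :=
  \sum_(i < N) u 0 i * v 0 i.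

(* A (geometric) polytope of rank N in R^N: a finite set of proper faces, with a
   rank function, an incidence partial order, and positions of the vertices
   (faces of rank 0).  [pos] is only meaningful on vertices. *)
Record polytope (C : numClosedFieldType) (N : nat) := Polytope {
  face : finType;
  rank : face -> nat;
  incid : rel face;          (* F <= G *)
  pos : face -> 'rV[C]_N
}.

Section Defs.
Variables (C : numClosedFieldType) (N : nat) (P : polytope C N).

Definition vertex (F : face P) : bool := rank F == 0%N.

Definition is_flag (f : {ffun 'I_N -> face P}) : Prop :=
  (forall i : 'I_N, rank (f i) = i) /\
  (forall i j : 'I_N, (i <= j)%N -> incid (f i) (f j)).

Definition flag_adj (f g : {ffun 'I_N -> face P}) : bool :=
  #|[set i | f i != g i]| == 1%N.

(* abstract polytope axioms (McMullen--Schulte), improper faces left implicit *)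
Definition partial_order_ax : Prop :=
  [/\ (forall F : face P, incid F F),
      (forall F G : face P, incid F G -> incid G F -> F = G) &
      (forall F G H : face P, incid F G -> incid G H -> incid F H)].

Definition rank_ax : Prop :=
  (forall F : face P, (rank F < N)%N) /\
  (forall F G : face P, incid F G -> F != G -> (rank F < rank G)%N).

(* a flag exists; every chain F <= G extends to a flag (so all maximal chains
   are flags) *)
Definition flag_ax : Prop :=
  (exists f, is_flag f) /\
  (forall F G : face P, incid F G ->
     exists f, is_flag f /\ (exists i, f i = F) /\ (exists j, f j = G)).

(* diamond condition (including the cases involving the improper faces) *)
Definition diamond_ax : Prop :=
  [/\ (forall F G : face P, incid F G -> rank G = (rank F + 2)%N ->
         #|[set H | [&& incid F H, incid H G & rank H == (rank F).+1]]| = 2%N),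
      (forall G : face P, rank G = 1%N -> #|[set H | incid H G & rank H == 0%N]| = 2%N) &
      (forall F : face P, rank F = (N - 2)%N ->
         #|[set H | incid F H & rank H == N.-1]| = 2%N)].

Definition strong_flag_connected : Prop :=
  forall f g, is_flag f -> is_flag g ->
    exists s : seq {ffun 'I_N -> face P},
      [/\ path flag_adj f s, last f s = g &
          forall h, h \in s -> is_flag h /\ forall i, f i = g i -> h i = f i].

Definition abstract_polytope : Prop :=
  [/\ partial_order_ax, rank_ax, flag_ax, diamond_ax & strong_flag_connected].

Definition aff_rank (A : pred (face P)) (p0 : 'rV[C]_N) : nat :=
  \rank (\sum_(v | vertex v && A v) <<pos v - p0>>)%MS.

(* realisation in R^N: real, injective on vertices; every j-face spans an affine
   j-space (planar faces, as in Coxeter); the whole polytope spans R^N *)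
Definition realization : Prop :=
  [/\ (forall v, vertex v -> realv (pos v)),
      (forall v w, vertex v -> vertex w -> pos v = pos w -> v = w),
      (forall F v0, vertex v0 -> incid v0 F ->
         aff_rank (fun v => incid v F) (pos v0) = rank F) &
      (forall v0, vertex v0 -> aff_rank predT (pos v0) = N)].

Definition symmetry (s : face P -> face P) (Q : 'M[C]_N) (t : 'rV[C]_N) : Prop :=
  [/\ bijective s,
      (forall F, rank (s F) = rank F),
      (forall F G, incid (s F) (s G) = incid F G),
      (realmx Q /\ Q *m Q^T = 1%:M /\ realv t) &
      (forall v, vertex v -> pos (s v) = pos v *m Q + t)].

Definition regular_polytope : Prop :=
  [/\ abstract_polytope, realization &
      forall f g, is_flag f -> is_flag g ->
        exists s Q t, symmetry s Q t /\ forall i, s (f i) = g i].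

Definition adjv (x y : face P) : bool :=
  [&& vertex x, vertex y, x != y &
      [exists e, [&& rank e == 1%N, incid x e & incid y e]]].

Definition degree (x : face P) : nat := #|[set y | adjv x y]|.

Definition equation1 (phi : face P -> C) (gamma : C) (x : face P) : Prop :=
  gamma / (degree x)%:R * (\sum_(y | adjv x y) (phi y - phi x)) ^+ 2
  = \sum_(y | adjv x y) (phi x - phi y) ^+ 2.

End Defs.

Definition orth_proj (C : numClosedFieldType) (N : nat) (e1 e2 : 'rV[C]_N) :=
  fun y : 'rV[C]_N => dotv e1 y + 'i * dotv e2 y.

Definition orthonormal_pair (C : numClosedFieldType) (N : nat) (e1 e2 : 'rV[C]_N) : Prop :=
  [/\ realv e1, realv e2, dotv e1 e1 = 1, dotv e2 e2 = 1 & dotv e1 e2 = 0].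

(* Main.v *)
(* Fix a flag and let c_k be the centroid of the vertices of its k-face (c_N that
   of all vertices).  Flag transitivity makes the edges b_k = c_k - c_(k+1) of this
   orthoscheme pairwise orthogonal, and strong flag connectedness makes them nonzero
   and yields, for each k, a symmetry fixing every c_j with j != k but moving c_k.
   Let S = sum u^T u and m = sum u, where u runs over the edge vectors at x = c_0.
   Both are invariant under the symmetries with k >= 1, whose mirrors have normals
   b_(k-1)/|b_(k-1)|^2 - b_k/|b_k|^2; since consecutive normals are not orthogonal,
   S = lambda I + mu d^T d and m = nu d with d = x - c_N.  A projection is the pairing
   with p = e1 + i e2, which satisfies <p, p> = 0, so p S p^T = (mu / nu^2) <p, m>^2. *)
Require Import Defs.
From HB Require Import structures.
From mathcomp Require Import all_boot all_order all_algebra ring.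
Import Order.TTheory GRing.Theory Num.Theory.
Local Open Scope ring_scope.
Set Implicit Arguments. Unset Strict Implicit. Unset Printing Implicit Defensive.

(** * The bilinear, non-Hermitian dot product on row vectors *)

Section DotProduct.
Variables (C : numClosedFieldType) (n : nat).
Implicit Types u v w : 'rV[C]_n.

Lemma dotvE u v : dotv u v = (u *m v^T) 0 0.
Proof. by rewrite mxE; apply: eq_bigr => i _; rewrite mxE. Qed.

Lemma dotvC u v : dotv u v = dotv v u.
Proof. by apply: eq_bigr => i _; rewrite mulrC. Qed.

Lemma dotvDl u v w : dotv (u + v) w = dotv u w + dotv v w.
Proof. by rewrite !dotvE mulmxDl mxE. Qed.

Lemma dotvBl u v w : dotv (u - v) w = dotv u w - dotv v w.
Proof. by rewrite !dotvE mulmxBl !mxE. Qed.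

Lemma dotvZl a u v : dotv (a *: u) v = a * dotv u v.
Proof. by rewrite !dotvE -scalemxAl mxE. Qed.

Lemma dot0v v : dotv 0 v = 0.
Proof. by rewrite dotvE mul0mx mxE. Qed.

Lemma dotv_suml I (r : seq I) (A : pred I) (F : I -> 'rV_n) v :
  dotv (\sum_(i <- r | A i) F i) v = \sum_(i <- r | A i) dotv (F i) v.
Proof. by rewrite dotvE mulmx_suml summxE; apply: eq_bigr => i _; rewrite dotvE. Qed.

Lemma dotvDr u v w : dotv w (u + v) = dotv w u + dotv w v.
Proof. by rewrite dotvC dotvDl !(dotvC w). Qed.

Lemma dotvBr u v w : dotv w (u - v) = dotv w u - dotv w v.
Proof. by rewrite dotvC dotvBl !(dotvC w). Qed.

Lemma dotvZr a u v : dotv u (a *: v) = a * dotv u v.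
Proof. by rewrite dotvC dotvZl dotvC. Qed.

Lemma dotv_sumr I (r : seq I) (A : pred I) (F : I -> 'rV_n) v :
  dotv v (\sum_(i <- r | A i) F i) = \sum_(i <- r | A i) dotv v (F i).
Proof. by rewrite dotvC dotv_suml; apply: eq_bigr => i _; rewrite dotvC. Qed.

Lemma dotv_mulr u v (A : 'M_n) : dotv u (v *m A) = dotv (u *m A^T) v.
Proof. by rewrite !dotvE trmx_mul mulmxA. Qed.

Lemma dotv_isometry (Q : 'M_n) u v :
  Q *m Q^T = 1%:M -> dotv (u *m Q) (v *m Q) = dotv u v.
Proof. by move=> QQ; rewrite dotv_mulr -mulmxA QQ mulmx1. Qed.

Lemma realv_dotv u v : realv u -> realv v -> dotv u v \is Num.real.
Proof. by move=> ur vr; apply: rpred_sum => i _; apply: rpredM. Qed.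

Lemma realvB u v : realv u -> realv v -> realv (u - v).
Proof. by move=> ur vr i; rewrite !mxE rpredB. Qed.

Lemma dotv_ge0 v : realv v -> 0 <= dotv v v.
Proof. by move=> vr; apply: sumr_ge0 => i _; rewrite -expr2 real_exprn_even_ge0. Qed.

Lemma dotv_eq0 v : realv v -> (dotv v v == 0) = (v == 0).
Proof.
move=> vr; apply/eqP/eqP => [|->]; last by rewrite dot0v.
move/eqP; rewrite psumr_eq0 => [|i _]; last first.
  by rewrite -expr2 real_exprn_even_ge0.
move/allP => v0; apply/rowP => i; rewrite mxE; apply/eqP.
by have := v0 i (mem_index_enum _); rewrite mulf_eq0 orbb.
Qed.

End DotProduct.

(** * Orthogonal bases and tensors invariant under orthoscheme mirrors *)

Section OrthogonalFamily.
Variables (C : numClosedFieldType) (n : nat) (b : nat -> 'rV[C]_n).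

(** Pairing a vanishing combination with [b i] isolates its [i]-th coefficient; a nonzero complex
    vector may be isotropic, hence the second hypothesis. *)
Lemma orthogonal_row_free k :
  (forall i j, (i < k)%N -> (j < k)%N -> i != j -> dotv (b i) (b j) = 0) ->
  (forall i, (i < k)%N -> dotv (b i) (b i) != 0) ->
  row_free (\matrix_(i < k) b i).
Proof.
move=> orth nz; apply: inj_row_free => v vB0; apply/rowP => i; rewrite mxE.
have : dotv (v *m \matrix_(i < k) b i) (b i) = 0 by rewrite vB0 dot0v.
rewrite mulmx_sum_row dotv_suml (bigD1 i) //= big1 => [|j ji].
  by rewrite addr0 rowK dotvZl => /eqP; rewrite mulf_eq0 (negPf (nz _ _)) // orbF => /eqP.
by rewrite rowK dotvZl orth ?mulr0.
Qed.

Hypothesis orth :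
  forall i j, (i < n)%N -> (j < n)%N -> i != j -> dotv (b i) (b j) = 0.
Hypothesis nz : forall i, (i < n)%N -> dotv (b i) (b i) != 0.

(** The difference of the two sides is orthogonal to every [b k], and these form an invertible
    matrix. *)
Lemma orthogonal_expansion p :
  p = \sum_(i < n) (dotv p (b i) / dotv (b i) (b i)) *: b i.
Proof.
set q := \sum_(i < n) _; apply/eqP; rewrite -subr_eq0; apply/eqP.
set B := \matrix_(i < n) b i.
have Bu : B^T \in unitmx by rewrite unitmx_tr -row_free_unit orthogonal_row_free.
rewrite -[LHS](mulmxK Bu); suff -> : (p - q) *m B^T = 0 by rewrite mul0mx.
apply/rowP => k; rewrite [RHS]mxE.
have -> : ((p - q) *m B^T) 0 k = dotv (p - q) (b k).
  by rewrite mxE; apply: eq_bigr => i _; rewrite !mxE.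
rewrite dotvBl /q dotv_suml (bigD1 k) //= big1 => [|j jk].
  by rewrite addr0 dotvZl divfK ?subrr ?nz.
by rewrite dotvZl [X in _ * X]orth ?mulr0.
Qed.

(* In the application b is the sequence of consecutive edges of an orthoscheme
   and r is normal to the mirror that omits its i-th vertex; S and m are
   invariant under the reflection in that mirror. *)
Lemma orthoscheme_invariants (S : 'M_n) (m : 'rV_n) :
  (1 < n)%N -> S^T = S ->
  (forall i, (i.+1 < n)%N -> exists r : 'rV_n,
     [/\ r != 0,
         forall j, (j < n)%N -> j != i -> j != i.+1 ->
           dotv r (b j) = 0 /\ dotv (b j *m S) r = 0,
         dotv r (b i + b i.+1) = 0, dotv ((b i + b i.+1) *m S) r = 0 &
         dotv m r = 0]) ->
  exists la, forall p,
    dotv p m = dotv m (b 0) / dotv (b 0) (b 0) * dotv p (\sum_(i < n) b i) /\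
    dotv (p *m S) p = la * dotv p p +
      dotv (b 0 *m S) (b 1) / dotv (b 0) (b 0) / dotv (b 1) (b 1) *
        dotv p (\sum_(i < n) b i) ^+ 2.
Proof.
move=> n_gt1 symS mirror.
have [e eE] : {e | forall i, e i = (dotv (b i) (b i))^-1 *: b i} by eexists.
pose T i j := dotv (e i *m S) (e j).
have be i : (i < n)%N -> b i = dotv (b i) (b i) *: e i.
  by move=> ?; rewrite eE scalerA divff ?nz ?scale1r.
have TC i j : T i j = T j i by rewrite /T dotvC dotv_mulr symS.
(* In terms of the dual basis [e], the mirror normal is a nonzero multiple of [e i - e i.+1]. *)
have normal i : (i.+1 < n)%N ->
    exists2 r : 'rV_n, r = e i - e i.+1 &
     [/\ forall j, (j < n)%N -> j != i -> j != i.+1 -> dotv (b j *m S) r = 0,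
         dotv ((b i + b i.+1) *m S) r = 0 & dotv m r = 0].
  move=> i1n; have i_n := ltnW i1n; have [r [r0 rb rbi Sr mr]] := mirror i i1n.
  have rE : r = dotv r (b i) *: (e i - e i.+1).
    rewrite {1}[r]orthogonal_expansion (bigD1 (Ordinal i_n)) //=.
    rewrite (bigD1 (Ordinal i1n)) /=; last by rewrite -val_eqE /= gtn_eqF.
    rewrite big1 => [|j /andP[ji ji1]].
      have -> : dotv r (b i.+1) = - dotv r (b i).
        by apply/eqP; rewrite -addr_eq0 addrC -dotvDr rbi.
      by rewrite addr0 !eE scalerBr !scalerA mulNr scaleNr.
    by have [-> _] := rb j (ltn_ord j) ji ji1; rewrite mul0r scale0r.
  have t0 : dotv r (b i) != 0 by apply: contraNneq r0 => t0; rewrite rE t0 scale0r.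
  have cancel u : dotv u r = 0 -> dotv u (e i - e i.+1) = 0.
    by rewrite rE dotvZr => /eqP; rewrite mulf_eq0 (negPf t0) => /eqP.
  exists (e i - e i.+1) => //; split; [|exact: cancel..].
  by move=> j jn ji ji1; have [_ /cancel] := rb j jn ji ji1.
have m_const i : (i < n)%N -> dotv m (e i) = dotv m (e 0).
  elim: i => // i IH i1n; rewrite -(IH (ltnW i1n)).
  have [r -> [_ _ /eqP]] := normal i i1n.
  by rewrite dotvBr subr_eq0 => /eqP.
(* Adjacent entries of a row of [T] agree on each side of the diagonal; with symmetry this links
   every off-diagonal entry to [T 0 1]. *)
have T_step i j : (i.+1 < n)%N -> (j < n)%N -> j != i -> j != i.+1 ->
    T j i = T j i.+1.
  move=> i1n jn ji ji1; have [r -> [/(_ j jn ji ji1) + _ _]] := normal i i1n.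
  rewrite be // -scalemxAl dotvZl dotvBr => /eqP.
  by rewrite mulf_eq0 (negPf (nz jn)) subr_eq0 => /eqP.
have T_row0 j : (0 < j < n)%N -> T 0 j = T 0 1.
  case: j => // j /=; elim: j => // j IH jn.
  by rewrite -(IH (ltnW jn)) -T_step // ltnW.
have T_low j k : (k < j)%N -> (j < n)%N -> T j k = T 0 1.
  elim: k => [|k IH] kj jn; first by rewrite TC T_row0 ?kj.
  by rewrite -T_step ?IH ?gtn_eqF // ?(ltnW kj) // (ltn_trans kj).
have T_off j k : (j < n)%N -> (k < n)%N -> j != k -> T j k = T 0 1.
  by move=> jn kn; rewrite neq_ltn => /orP[jk|kj]; [rewrite TC|]; rewrite T_low.
(* Once the constant [T 0 1] is subtracted, [T] is diagonal; the condition on [b i + b i.+1] makes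
   it proportional to the Gram matrix of [e]. *)
pose la i := dotv (b i) (b i) * (T i i - T 0 1).
have la_const i : (i < n)%N -> la i = la 0.
  elim: i => // i IH i1n; rewrite -(IH (ltnW i1n)).
  have i_n := ltnW i1n.
  have [r -> [_ + _]] := normal i i1n.
  rewrite {1}(be i) // {1}(be i.+1) // mulmxDl -!scalemxAl dotvDl !dotvZl !dotvBr.
  rewrite -/(T _ _) -/(T i i.+1) -/(T i.+1 i) -/(T i.+1 i.+1) (TC i.+1 i) => E.
  have Tii : T i i.+1 = T 0 1 by rewrite T_off // ltn_eqF.
  rewrite Tii in E; apply/eqP; rewrite eq_sym -subr_eq0 -E /la; apply/eqP; ring.
exists (la 0) => p.
have pE : p = \sum_(i < n) dotv p (b i) *: e i.
  rewrite {1}[p]orthogonal_expansion; apply: eq_bigr => i _.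
  by rewrite eE scalerA.
split.
  rewrite {1}pE dotv_suml dotv_sumr mulr_sumr; apply: eq_bigr => i _.
  by rewrite dotvZl (dotvC (e i)) m_const // eE dotvZr mulrC (mulrC _ (dotv m _)).
have mu : dotv (b 0 *m S) (b 1) / dotv (b 0) (b 0) / dotv (b 1) (b 1) = T 0 1.
  by rewrite /T !eE -scalemxAl dotvZl dotvZr; ring.
rewrite mu dotv_sumr; set d := \sum_(i < n) dotv p (b i).
have -> : d ^+ 2 = \sum_(i < n) dotv p (b i) * d by rewrite expr2 {1}/d mulr_suml.
have -> : dotv p p = \sum_(i < n) dotv p (b i) ^+ 2 / dotv (b i) (b i).
  rewrite {1}pE dotv_suml; apply: eq_bigr => i _.
  by rewrite dotvZl (dotvC (e i)) eE dotvZr; ring.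
rewrite {1}pE mulmx_suml dotv_suml !mulr_sumr -big_split /=.
apply: eq_bigr => i _; rewrite -scalemxAl dotvZl {2}pE dotv_sumr.
rewrite /d (bigD1 i) //= [in RHS](bigD1 i) //= dotvZr -/(T i i).
rewrite (eq_bigr (fun j : 'I_n => T 0 1 * dotv p (b j))) => [|j ji]; last first.
  by rewrite dotvZr -/(T i j) T_off // 1?eq_sym // mulrC.
rewrite -mulr_sumr -(la_const i) // /la.
by field; rewrite nz.
Qed.

End OrthogonalFamily.

(** Applied below to a path of flags, with [F] the vertex set of the [k]-face. *)
Lemma path_change (T : eqType) (U : eqType) (e : rel T) (F : T -> U) x s :
  path e x s -> F (last x s) != F x ->
  exists y z, [/\ y \in x :: s, z \in x :: s, e y z & F y != F z].
Proof.
elim: s x => [|a s IH] x /=; first by rewrite eqxx.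
case/andP=> exa pas Fl; have [Fax|Fax] := eqVneq (F a) (F x); last first.
  by exists x, a; split; rewrite ?inE ?eqxx ?orbT // eq_sym.
rewrite -Fax in Fl; have [y [z [ys zs eyz Fyz]]] := IH a pas Fl.
by exists y, z; split; rewrite // in_cons ?ys ?zs orbT.
Qed.

(** * Centroids attached to a flag, and edge vectors at a vertex *)

Section Polytope.
Variables (C : numClosedFieldType) (n : nat) (P : polytope C n.+1).
Local Notation flag := {ffun 'I_n.+1 -> face P}.
Implicit Types (f g : flag) (s : face P -> face P) (A B D : {set face P}).

(* The improper maximal face is implicit in [polytope]; it is the case k = n.+1. *)
Definition vertices f k : {set face P} :=
  [set v | vertex v && ((k <= n)%N ==> incid v (f (inord k)))].

Definition centroid A : 'rV[C]_n.+1 := #|A|%:R^-1 *: \sum_(v in A) pos v.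

Definition center f k := centroid (vertices f k).

(** An edge of the orthoscheme of centroids; the edges of the polytope enter through [edge_sum] and
    [edge_form]. *)
Definition edge f k := center f k - center f k.+1.

Definition edge_sum (x : face P) := \sum_(y | adjv x y) (pos y - pos x).

Definition edge_form (x : face P) :=
  \sum_(y | adjv x y) (pos y - pos x)^T *m (pos y - pos x).

Lemma edge_form_sym x : (edge_form x)^T = edge_form x.
Proof.
by rewrite raddf_sum; apply: eq_bigr => y _; rewrite /= trmx_mul trmxK.
Qed.

Lemma dotv_edge_form x p q :
  dotv (p *m edge_form x) q =
  \sum_(y | adjv x y) dotv p (pos y - pos x) * dotv q (pos y - pos x).
Proof.
rewrite mulmx_sumr dotv_suml; apply: eq_bigr => y _.
rewrite mulmxA [_ *m _^T]mx11_scalar -dotvE mul_scalar_mx dotvZl.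
by rewrite (dotvC q).
Qed.

Lemma vertexP f k v : v \in vertices f k -> vertex v.
Proof. by rewrite inE => /andP[]. Qed.

Lemma centroid_dotv A D p c : A \subset D -> (0 < #|A|)%N ->
  (forall v, v \in D -> dotv p (pos v) = c) -> dotv p (centroid A) = c.
Proof.
move=> /subsetP AD A0 Dc; rewrite dotvZr dotv_sumr (eq_bigr (fun=> c)).
  by rewrite sumr_const -[c *+ _]mulr_natl mulKf // pnatr_eq0 -lt0n.
by move=> v /AD /Dc.
Qed.

Lemma centroid_sub A (v0 : face P) : (0 < #|A|)%N ->
  centroid A - pos v0 = #|A|%:R^-1 *: \sum_(v in A) (pos v - pos v0).
Proof.
move=> A0; rewrite sumrB scalerBr sumr_const -scaler_nat scalerA mulVf ?scale1r //.
by rewrite pnatr_eq0 -lt0n.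
Qed.

(** * Action of a single symmetry *)

Section Symmetries.
Variables (s : face P -> face P) (Q : 'M[C]_n.+1) (t : 'rV[C]_n.+1).
Hypothesis sQt : symmetry s Q t.

Lemma symmetry_inj : injective s.
Proof. by case: sQt => /bij_inj. Qed.

Lemma symmetry_orth : Q *m Q^T = 1%:M.
Proof. by case: sQt => _ _ _ [_ []]. Qed.

Lemma symmetry_vertex v : vertex (s v) = vertex v.
Proof. by case: sQt => _ rk _ _ _; rewrite /vertex rk. Qed.

Lemma symmetry_pos v : vertex v -> pos (s v) = pos v *m Q + t.
Proof. by case: sQt => _ _ _ _; apply. Qed.

Lemma symmetry_posB v w : vertex v -> vertex w ->
  pos (s v) - pos (s w) = (pos v - pos w) *m Q.
Proof. by move=> ? ?; rewrite !symmetry_pos // mulmxBl opprD addrACA subrr addr0. Qed.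

Lemma symmetry_flag f : is_flag f -> is_flag [ffun i => s (f i)].
Proof.
case: sQt => _ rk inc _ _ [f1 f2]; split => [i|i j ij]; first by rewrite ffunE rk.
by rewrite !ffunE inc f2.
Qed.

(** For [k > n] the premise is vacuous: a symmetry permutes the set of all vertices. *)
Lemma symmetry_vertices f g k : ((k <= n)%N -> s (f (inord k)) = g (inord k)) ->
  vertices g k = s @: vertices f k.
Proof.
case: sQt => -[s' sK s'K] _ inc _ _ fg; apply/setP => v.
rewrite -[v]s'K mem_imset; last exact: symmetry_inj.
rewrite !inE symmetry_vertex; congr (_ && _).
by case: leqP => //= kn; rewrite -fg ?inc.
Qed.

Lemma symmetry_centroid A : (0 < #|A|)%N -> (forall v, v \in A -> vertex v) ->
  centroid (s @: A) = centroid A *m Q + t.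
Proof.
move=> A0 Av; rewrite /centroid card_imset; last exact: symmetry_inj.
rewrite big_imset /=; last by move=> ? ? _ _ /symmetry_inj.
rewrite (eq_bigr (fun v => pos v *m Q + t)); last by move=> v /Av /symmetry_pos.
rewrite big_split /= sumr_const -scaler_nat scalerDr scalerA mulVf ?scale1r.
  by rewrite -mulmx_suml scalemxAl.
by rewrite pnatr_eq0 -lt0n.
Qed.

Lemma symmetry_adjv x y : adjv (s x) (s y) = adjv x y.
Proof.
case: sQt => -[s' sK s'K] rk inc _ _.
rewrite /adjv !symmetry_vertex (inj_eq symmetry_inj); congr [&& _, _, _ & _].
apply/existsP/existsP => -[e /and3P[e1 ex ey]]; last first.
  by exists (s e); rewrite rk !inc e1 ex.
by exists (s' e); rewrite -rk -(inc x) -(inc y) s'K e1 ex.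
Qed.

Lemma symmetry_degree x : degree (s x) = degree x.
Proof.
rewrite /degree -!sum1dep_card (reindex_inj symmetry_inj) /=.
by apply: eq_bigl => y; rewrite symmetry_adjv.
Qed.

Lemma symmetry_edge_sum x : vertex x -> edge_sum (s x) = edge_sum x *m Q.
Proof.
move=> xv; rewrite /edge_sum (reindex_inj symmetry_inj) mulmx_suml /=.
rewrite (eq_bigl (adjv x)) => [|y]; last by rewrite symmetry_adjv.
by apply: eq_bigr => y /and4P[_ yv _ _]; rewrite symmetry_posB.
Qed.

Lemma symmetry_edge_form x : vertex x -> edge_form (s x) = Q^T *m edge_form x *m Q.
Proof.
move=> xv; rewrite /edge_form (reindex_inj symmetry_inj) mulmx_sumr mulmx_suml /=.
rewrite (eq_bigl (adjv x)) => [|y]; last by rewrite symmetry_adjv.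
by apply: eq_bigr => y /and4P[_ yv _ _]; rewrite symmetry_posB // trmx_mul !mulmxA.
Qed.

End Symmetries.

(** * Flags and centroids of a regular polytope *)

Hypothesis hP : regular_polytope P.

Lemma incid_refl (F : face P) : incid F F.
Proof. by case: hP => -[[r _ _]]. Qed.

Lemma pos_real (v : face P) : vertex v -> realv (pos v).
Proof. by case: hP => _ [r _ _ _] _; apply: r. Qed.

Lemma pos_inj (v w : face P) : vertex v -> vertex w -> pos v = pos w -> v = w.
Proof. by case: hP => _ [_ r _ _] _; apply: r. Qed.

Lemma flag_transitive f g : is_flag f -> is_flag g ->
  exists s Q t, symmetry s Q t /\ forall i, s (f i) = g i.
Proof. by case: hP => _ _; apply. Qed.

Lemma flag_vertex f : is_flag f -> vertex (f ord0).
Proof. by case=> rk _; rewrite /vertex rk. Qed.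

Lemma flag_vertices f k : is_flag f -> f ord0 \in vertices f k.
Proof.
move=> ff; rewrite inE flag_vertex //=; apply/implyP => kn.
by case: ff => _; apply.
Qed.

Lemma card_vertices f k : is_flag f -> (0 < #|vertices f k|)%N.
Proof. by move=> ff; apply/card_gt0P; exists (f ord0); apply: flag_vertices. Qed.

Lemma vertices_sub f i j : is_flag f -> (i <= j)%N -> vertices f i \subset vertices f j.
Proof.
case=> _ inc ij; apply/subsetP => v; rewrite !inE => /andP[-> /=].
case: (leqP j n) => //= jn; rewrite (leq_trans ij jn) /= => vi.
case: hP => -[[_ _ tr] _ _ _ _] _ _; apply: tr vi _.
by apply: inc; rewrite !inordK // ltnS (leq_trans ij).
Qed.

Lemma center_real f k : realv (center f k).
Proof.
move=> i; rewrite mxE summxE; apply: rpredM; first by rewrite rpredV rpred_nat.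
by apply: rpred_sum => v /vertexP /pos_real.
Qed.

Lemma symmetry_center s Q t f g k : symmetry s Q t -> is_flag f ->
  ((k <= n)%N -> s (f (inord k)) = g (inord k)) -> center g k = center f k *m Q + t.
Proof.
move=> sQt ff fg; rewrite /center (symmetry_vertices sQt fg) (symmetry_centroid sQt) //.
  exact: card_vertices.
exact: vertexP.
Qed.

(** Two flags are glued at rank [k]: below it one through [v] and the [k]-face of [f], from there
    upwards [f]. If [k > n], any flag through [v] works. *)
Lemma flag_through f k v : is_flag f -> v \in vertices f k ->
  exists g, [/\ is_flag g, g ord0 = v & forall j : 'I_n.+1, (k <= j)%N -> g j = f j].
Proof.
move=> ff; rewrite inE => /andP[v0 vk].
have [[_ _ tr] rkax [_ ext] _ _] : abstract_polytope P by case: hP.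
(* Extending a chain places [v] at an unknown index, which its rank forces to be 0. *)
have v_ord0 h (i : 'I_n.+1) : is_flag h -> h i = v -> h ord0 = v.
  move=> [rk _] hi; rewrite -hi; congr (h _); apply: val_inj => /=.
  by rewrite -rk hi; apply/esym/eqP.
case: (leqP k n) vk => [kn /= vk|nk _]; last first.
  have [h [hf [[i hi] _]]] := ext _ _ (incid_refl v).
  exists h; split => // [|j]; first exact: v_ord0 hi.
  by rewrite leqNgt (leq_trans (ltn_ord j)).
have [h [hf [[i hi] [l hl]]]] := ext _ _ vk.
have {l hl} hk : h (inord k) = f (inord k).
  suff {1}<- : l = inord k by exact: hl.
  by apply: val_inj; case: hf ff => rk _ [rk' _]; rewrite /= -rk hl rk'.
exists [ffun j : 'I_n.+1 => if (k <= j)%N then f j else h j]; split.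
- case: hf ff => rk inc [rk' inc']; split => [j|j l jl]; rewrite !ffunE.
    by case: ifP.
  case: (leqP k j) => kj; first by rewrite (leq_trans kj jl) inc'.
  case: (leqP k l) => kl; last exact: inc.
  apply: (tr _ (f (inord k))); last by apply: inc'; rewrite inordK.
  by rewrite -hk; apply: inc; rewrite inordK // ltnW.
- rewrite ffunE /=; case: leqP => [k0|_]; last exact: v_ord0 hi.
  rewrite -(v_ord0 h i) // (_ : ord0 = inord k) ?hk //.
  by apply: val_inj; rewrite /= inordK //; apply/esym/eqP; rewrite -leqn0.
- by move=> j kj; rewrite ffunE kj.
Qed.

(** A symmetry relates flags through [v] and [w] that agree with [f] from rank [i] on. It fixes
    centres [j] and [k] and takes [v] to [w], so both have the same product with the difference of
    the centres. *)
Lemma center_orth f i j k v w : is_flag f -> (i <= j)%N -> (i <= k)%N ->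
  v \in vertices f i -> w \in vertices f i ->
  dotv (center f j - center f k) (pos v - pos w) = 0.
Proof.
move=> ff ij ik vi wi.
have [g [gf gv gE]] := flag_through ff vi.
have [h [hf hw hE]] := flag_through ff wi.
have [s [Q [t [sQt gh]]]] := flag_transitive gf hf.
have sE l : (i <= l)%N -> (l <= n)%N -> s (f (inord l)) = f (inord l).
  by move=> il ln; rewrite -gE ?gh ?hE ?gE ?inordK.
have fixed l : (i <= l)%N -> center f l = center f l *m Q + t.
  by move=> il; apply: (symmetry_center sQt ff) => ln; apply: sE.
have sv : pos w = pos v *m Q + t.
  by rewrite -gv -hw -gh (symmetry_pos sQt) // flag_vertex.
have diff : (center f j - center f k) *m Q = center f j - center f k.
  by rewrite [in RHS](fixed j) // [in RHS](fixed k) // mulmxBl opprD addrACA subrr addr0.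
have -> : pos v - pos w = (pos v - center f k) - (pos w - center f k).
  by rewrite opprB addrA subrK.
rewrite dotvBr -(dotv_isometry _ (pos v - _) (symmetry_orth sQt)) diff.
have -> : (pos v - center f k) *m Q = pos w - center f k.
  by rewrite sv [in RHS](fixed k) // mulmxBl opprD addrACA subrr addr0.
exact: subrr.
Qed.

(** For [i < j] the product with [edge f j] is constant on the vertices of the [j]-face, hence equal
    at centres [i] and [i.+1], which average such vertices. *)
Lemma edge_orth f i j : is_flag f -> i != j -> dotv (edge f i) (edge f j) = 0.
Proof.
move=> ff; wlog ij : i j / (i < j)%N => [H|_].
  by rewrite neq_ltn => /orP[ij|ij]; [|rewrite dotvC]; rewrite H ?ltn_eqF.
have const l : (l <= j)%N ->
    dotv (edge f j) (center f l) = dotv (edge f j) (pos (f ord0)).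
  move=> lj; apply: (centroid_dotv (vertices_sub ff lj)); first exact: card_vertices.
  move=> v vj; apply/eqP; rewrite -subr_eq0 -dotvBr; apply/eqP.
  by apply: (center_orth ff (leqnn j) (leqnSn j)); rewrite // flag_vertices.
by rewrite dotvC {2}/edge dotvBr !const ?subrr // ltnW.
Qed.

(** * Nondegeneracy of the orthoscheme *)

Lemma edge_real f k : realv (edge f k).
Proof. by apply: realvB; apply: center_real. Qed.

(** The direction space of the affine hull of the [k]-face. *)
Definition directions f k := (\sum_(v in vertices f k) <<pos v - pos (f ord0)>>)%MS.

Lemma rank_directions f k : is_flag f -> (k <= n.+1)%N -> \rank (directions f k) = k.
Proof.
move=> ff kn; have [_ [_ _ facerk toprk] _] := hP.
have := flag_vertices k ff; rewrite inE => /andP[v0].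
case: (leqP k n) => /= [kn' x_k|nk _].
  have [rk _] := ff; rewrite -[RHS](@inordK n k) // -rk -(facerk _ _ v0 x_k).
  by congr (\rank _); apply: eq_bigl => v; rewrite inE kn'.
have -> : k = n.+1 by apply/eqP; rewrite eqn_leq kn.
rewrite -[RHS](toprk _ v0); congr (\rank _); apply: eq_bigl => v.
by rewrite inE ltnn.
Qed.

(* If all k-adjacent flags had equal vertex sets in rank k, then by strong flag
   connectedness every vertex of the (k+1)-face would lie on the k-face, and both
   would span the same affine space. *)
Lemma adjacent_flags_vertices_neq k : (k <= n)%N ->
  exists g g', [/\ is_flag g, is_flag g',
    forall j : 'I_n.+1, j != k :> nat -> g j = g' j & vertices g k != vertices g' k].
Proof.
move=> kn; have [[_ _ [[f ff] _] _ conn] _ _] := hP.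
have : vertices f k \proper vertices f k.+1.
  rewrite properEneq (vertices_sub ff (leqnSn k)) andbT.
  apply/eqP => E; have := rank_directions ff (leqW kn : k <= n.+1)%N.
  have := rank_directions ff (kn : k.+1 <= n.+1)%N.
  by rewrite /directions -E => -> /eqP; rewrite gtn_eqF.
case/properP => _ [v vk1 vk].
have [h [hf hv hE]] := flag_through ff vk1.
have [p [pp lp pE]] := conn _ _ ff hf.
have flagp g : g \in f :: p -> is_flag g.
  by rewrite inE => /predU1P[->|/pE[]].
have : vertices (last f p) k != vertices f k.
  by rewrite lp; apply: contraNneq vk => <-; rewrite -hv flag_vertices.
case/(path_change (F := vertices^~ k) pp) => g [g' [gp gp' adj gg']].
exists g, g'; split; [exact: flagp | exact: flagp | | exact: gg'].
(* Adjacent flags differ at one rank only; a difference at [j != k] would leave the [k]-faces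
   equal. *)
move=> j jk; apply/eqP; apply: contraNT gg' => gj.
case/cards1P: adj => i ii.
have ij : j = i by apply/set1P; rewrite -ii inE.
apply/eqP/setP => w; rewrite !inE; suff -> : g (inord k) = g' (inord k) by [].
apply/eqP; have : inord k \notin [set l | g l != g' l].
  by rewrite ii inE -ij; apply: contraNneq jk => <-; rewrite inordK.
by rewrite inE negbK.
Qed.

(** The first [k] edges are nonzero and orthogonal, hence a basis of the [k]-dimensional direction
    space, and [Q] fixes each of them. *)
Lemma fixed_face f k (Q : 'M[C]_n.+1) : is_flag f -> (k <= n)%N ->
  (forall j, (j < k)%N -> edge f j != 0) ->
  (forall j, (j < k)%N -> edge f j *m Q = edge f j) ->
  forall v, v \in vertices f k ->
    (pos v - pos (f ord0)) *m Q = pos v - pos (f ord0).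
Proof.
move=> ff kn nz fix_edge v vk; set B := \matrix_(j < k) edge f j.
have BQ : B *m Q = B by apply/row_matrixP => j; rewrite row_mul rowK fix_edge.
have Bfree : row_free B.
  apply: orthogonal_row_free => [i j _ _|i ik]; first exact: edge_orth.
  by rewrite dotv_eq0 ?nz //; apply: edge_real.
have in_dirs w : w \in vertices f k -> (pos w - pos (f ord0) <= directions f k)%MS.
  by move=> wk; apply: (sumsmx_sup w); rewrite // genmxE.
have center_in l : (l <= k)%N -> (center f l - pos (f ord0) <= directions f k)%MS.
  move=> lk; rewrite centroid_sub ?card_vertices // scalemx_sub //.
  by apply: summx_sub => w wl; apply/in_dirs/(subsetP (vertices_sub ff lk)).
have Bsub : (B <= directions f k)%MS.
  apply/row_subP => j; rewrite rowK /edge -(subrKA (pos (f ord0))).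
  rewrite addmx_sub // ?eqmx_opp ?center_in // ?(ltnW (ltn_ord j)) //.
  by rewrite -opprB eqmx_opp center_in.
have /submxP[c ->] : (pos v - pos (f ord0) <= B)%MS.
  apply: submx_trans (in_dirs v vk) _.
  have := mxrank_leqif_sup Bsub; rewrite (eqP Bfree) rank_directions ?(leqW kn) //.
  by case=> _ <-.
by rewrite -mulmxA BQ.
Qed.

(** Two flags that differ only at rank [k], with different [k]-vertex sets, are moved so that the
    first becomes [f]; the symmetry sends [f] to the second. If it fixed centre [k] too, it would
    fix all edges, then every vertex of the [k]-face, and the vertex sets would agree. *)
Lemma moving_symmetry f k : is_flag f -> (k <= n)%N ->
  (forall j, (j < k)%N -> edge f j != 0) ->
  exists s Q t, [/\ symmetry s Q t, forall j : 'I_n.+1, j != k :> nat -> s (f j) = f j,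
    forall j, j != k -> center f j *m Q + t = center f j &
    center f k *m Q + t != center f k].
Proof.
move=> ff kn nz.
have [g [g' [gf gf' gg' gk]]] := adjacent_flags_vertices_neq kn.
have [r [R [u [rRu rE]]]] := flag_transitive gf ff.
pose f' : flag := [ffun i => r (g' i)].
have [s [Q [t [sQt sE]]]] := flag_transitive ff (symmetry_flag rRu gf').
have sf (j : 'I_n.+1) : j != k :> nat -> s (f j) = f j.
  by move=> jk; rewrite sE ffunE -gg' // rE.
have cE j : j != k -> center f j *m Q + t = center f j.
  move=> jk; rewrite -(symmetry_center (g := f) sQt ff) // => jn.
  by rewrite sf ?inordK.
exists s, Q, t; split => //; apply: contraNneq gk => ck.
have fixed j : center f j *m Q + t = center f j.
  by have [->|/cE] := eqVneq j k.
have eQ j : edge f j *m Q = edge f j.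
  rewrite /edge -[in RHS](fixed j) -[in RHS](fixed j.+1).
  by rewrite mulmxBl opprD addrACA subrr addr0.
(* [Q] fixes vectors inside the [k]-face, so its vertices are displaced exactly as its centre is. *)
have posQ v : v \in vertices f k -> pos v *m Q - pos v = center f k *m Q - center f k.
  move=> vk; have dQ w : w \in vertices f k -> (pos w - pos v) *m Q = pos w - pos v.
    move=> wk; have E := fixed_face ff kn nz (fun j _ => eQ j).
    have -> : pos w - pos v = (pos w - pos (f ord0)) - (pos v - pos (f ord0)).
      by rewrite opprB addrA subrK.
    by rewrite mulmxBl !E.
  have cv : (center f k - pos v) *m Q = center f k - pos v.
    rewrite centroid_sub ?card_vertices // -scalemxAl mulmx_suml; congr (_ *: _).
    by apply: eq_bigr => w /dQ.
  have -> : pos v *m Q = center f k *m Q - (center f k - pos v).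
    by rewrite -cv mulmxBl opprB addrC subrK.
  by rewrite opprB -addrA [_ - _ - _]addrAC subrr add0r.
have sv v : v \in vertices f k -> s v = v.
  move=> vk; have vv := vertexP vk.
  apply: pos_inj; rewrite ?(symmetry_vertex sQt) // (symmetry_pos sQt) //.
  by apply/eqP; rewrite -subr_eq0 addrAC posQ // addrAC ck subrr.
have Vf' : vertices f' k = vertices f k.
  rewrite (symmetry_vertices (f := f) sQt) => [|_]; last by rewrite sE.
  rewrite -[RHS]imset_id; exact: eq_in_imset.
have Vf : vertices f k = r @: vertices g k by apply: (symmetry_vertices rRu) => _.
have Vg' : vertices f' k = r @: vertices g' k.
  by apply: (symmetry_vertices rRu) => _; rewrite ffunE.
by apply/eqP/(imset_inj (symmetry_inj rRu)); rewrite -Vf -Vg' Vf'.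
Qed.

(** By induction the earlier edges are nonzero, so some symmetry moves centre [k] but not centre
    [k.+1]. *)
Lemma edge_neq0 f k : is_flag f -> (k <= n)%N -> edge f k != 0.
Proof.
move=> ff; elim/ltn_ind: k => k IH kn.
have [|s [Q [t [_ _ cE]]]] := moving_symmetry ff kn.
  by move=> j jk; apply: IH => //; rewrite ltnW // (leq_trans jk).
apply: contraNneq => /eqP; rewrite subr_eq0 => /eqP ->.
by apply/eqP/cE; rewrite gtn_eqF.
Qed.

(** * The edge vectors at the base vertex *)

Lemma center0 f : is_flag f -> center f 0 = pos (f ord0).
Proof.
move=> ff; rewrite /center /centroid.
suff -> : vertices f 0 = [set f ord0] by rewrite cards1 big_set1 invr1 scale1r.
apply/setP => v; rewrite in_set1; apply/idP/eqP => [|->]; last exact: flag_vertices.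
have -> : ord0 = inord 0 :> 'I_n.+1 by apply: val_inj; rewrite /= inordK.
rewrite inE /= => /andP[v0 inc]; apply/eqP; have [[_ [_ rk] _ _ _] _ _] := hP.
apply: contraTT isT => /(rk _ _ inc); case: ff => -> _.
by rewrite inordK // ltn0.
Qed.

Lemma sum_edges f : is_flag f ->
  \sum_(i < n.+1) edge f i = pos (f ord0) - center f n.+1.
Proof.
move=> ff; rewrite -(big_mkord xpredT (edge f)) -center0 // -opprB.
rewrite -(telescope_sumr (center f)) // -sumrN.
by apply: eq_bigr => i _; rewrite opprB.
Qed.

(** Without a second vertex the direction space of the 1-face would be zero, not a line. *)
Lemma has_neighbour f : is_flag f -> (0 < n)%N -> exists y, adjv (f ord0) y.
Proof.
move=> ff n0; have [rk _] := ff.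
have [|all_x] := boolP [exists v in vertices f 1, v != f ord0].
  case/exists_inP => y; rewrite inE n0 /= => /andP[yv ye] yx.
  exists y; rewrite /adjv flag_vertex // yv eq_sym yx.
  apply/existsP; exists (f (inord 1)); rewrite rk inordK // ye andbT /=.
  by have := flag_vertices 1 ff; rewrite inE n0 => /andP[].
have := rank_directions ff (leqW n0 : 1 <= n.+1)%N.
rewrite /directions big1 ?mxrank0 // => v vk.
suff -> : v = f ord0 by rewrite subrr genmx0.
by apply/eqP; move: all_x; rewrite negb_exists_in => /forall_inP/(_ v vk); rewrite negbK.
Qed.

(** All vertices are equidistant from the centre, so [2 <d, u> = - |u|^2] for each edge vector [u];
    the sum is negative because a neighbour exists. *)
Lemma dotv_edge_sum_neq0 f : is_flag f -> (0 < n)%N ->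
  dotv (pos (f ord0) - center f n.+1) (edge_sum (f ord0)) != 0.
Proof.
move=> ff n0; set x := f ord0; set d := _ - _.
have xv : vertex x := flag_vertex ff.
have polar (u w : 'rV[C]_n.+1) :
    dotv (w + u) (w + u) = dotv w w -> dotv w u *+ 2 = - dotv u u.
  rewrite !(dotvDl, dotvDr) (dotvC u w) => /eqP.
  rewrite -subr_eq0 => /eqP E; apply/eqP; rewrite -subr_eq0 -E; apply/eqP; ring.
have dy y : adjv x y ->
    dotv d (pos y - pos x) *+ 2 = - dotv (pos y - pos x) (pos y - pos x).
  case/and4P => _ yv _ _.
  have ytop : y \in vertices f n.+1 by rewrite inE yv ltnn.
  have [g [gf gy _]] := flag_through ff ytop.
  have [s [Q [t [sQt sg]]]] := flag_transitive ff gf.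
  have cg : center f n.+1 = center f n.+1 *m Q + t.
    by apply: (symmetry_center (g := f) sQt ff); rewrite ltnn.
  have dQ : d *m Q = d + (pos y - pos x).
    rewrite addrC /d addrA subrK -gy -sg (symmetry_pos sQt) // [in RHS]cg.
    by rewrite mulmxBl opprD addrACA subrr addr0.
  by apply: polar; rewrite -dQ (dotv_isometry _ _ (symmetry_orth sQt)).
have ur y : adjv x y -> realv (pos y - pos x).
  by case/and4P => _ yv _ _; apply: realvB; apply: pos_real.
apply/negP => /eqP m0; have [y xy] := has_neighbour ff n0.
have : \sum_(y | adjv x y) dotv (pos y - pos x) (pos y - pos x) = 0.
  apply/eqP; rewrite -oppr_eq0 -sumrN -(eq_bigr _ dy) sumrMnl -dotv_sumr.
  by rewrite -/(edge_sum x) m0 mul0rn.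
move/psumr_eq0P => /(_ (fun y xy => dotv_ge0 (ur y xy)) y xy)/eqP.
rewrite dotv_eq0 ?subr_eq0; last exact: ur.
case/and4P: xy => _ yv + _ /eqP /pos_inj E.
by rewrite E // eqxx.
Qed.

(* Any u fixed by the moving symmetry Q is orthogonal to c - c Q, since
   <u, c> = <u Q, c Q> = <u, c Q>; this makes c - c Q normal to the mirror. *)
Lemma edge_mirror f i : is_flag f -> (i.+1 < n.+1)%N -> exists r : 'rV[C]_n.+1,
  [/\ r != 0,
      forall j, (j < n.+1)%N -> j != i -> j != i.+1 ->
        dotv r (edge f j) = 0 /\ dotv (edge f j *m edge_form (f ord0)) r = 0,
      dotv r (edge f i + edge f i.+1) = 0,
      dotv ((edge f i + edge f i.+1) *m edge_form (f ord0)) r = 0 &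
      dotv (edge_sum (f ord0)) r = 0].
Proof.
move=> ff i_n; set x := f ord0; have xv : vertex x := flag_vertex ff.
(* Rank [i.+1] is positive, so [x] is fixed; only edges [i] and [i.+1] meet the moving centre. *)
have [|s [Q [t [sQt sf cQ ck]]]] := moving_symmetry ff (i_n : i.+1 <= n)%N.
  by move=> j ji; apply: edge_neq0 => //; rewrite -ltnS (ltn_trans ji).
have sx : s x = x by apply: sf.
(* Measured from the fixed overall centre, so that [a - a *m Q] is, up to sign, the displacement of
   centre [i.+1]. *)
pose a := center f i.+1 - center f n.+1.
have cBQ j l : j != i.+1 -> l != i.+1 ->
    (center f j - center f l) *m Q = center f j - center f l.
  move=> ji li; rewrite -[in RHS](cQ j) // -[in RHS](cQ l) //.
  by rewrite mulmxBl opprD addrACA subrr addr0.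
have rE u : u *m Q = u -> dotv u (a - a *m Q) = 0.
  by move=> uQ; rewrite dotvBr -{2}uQ (dotv_isometry _ _ (symmetry_orth sQt)) subrr.
have SQ : edge_form x *m Q = Q *m edge_form x.
  have := symmetry_edge_form sQt xv; rewrite sx => E.
  by rewrite [in RHS]E !mulmxA (symmetry_orth sQt) mul1mx.
have rS u : u *m Q = u -> dotv (u *m edge_form x) (a - a *m Q) = 0.
  by move=> uQ; apply: rE; rewrite -mulmxA SQ mulmxA uQ.
have bb : edge f i + edge f i.+1 = center f i - center f i.+2.
  by rewrite /edge addrA subrK.
have bbQ : (edge f i + edge f i.+1) *m Q = edge f i + edge f i.+1.
  by rewrite bb cBQ // ?(ltn_eqF (ltnSn _)) ?(gtn_eqF (ltnSn _)).
exists (a - a *m Q); split.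
- apply: contraNneq ck => /eqP; rewrite subr_eq0 => /eqP aQ.
  rewrite -[eqbRHS](subrK (center f n.+1)) -/a aQ mulmxBl.
  by rewrite -{2}(cQ n.+1) ?gtn_eqF // addrA subrK.
- move=> j jn ji ji1.
  have eQ : edge f j *m Q = edge f j by apply: cBQ; rewrite // eqSS.
  by rewrite dotvC rE ?rS.
- by rewrite dotvC rE.
- exact: rS.
- by apply: rE; rewrite -(symmetry_edge_sum sQt xv) sx.
Qed.

(** An isotropic [p] kills the scalar part of the form; what is left is a multiple of the squared
    pairing with [edge_sum]. The factor is real although [p] is complex, since it comes from real
    vectors. *)
Lemma isotropic_edge_form f : is_flag f -> (0 < n)%N ->
  exists2 gamma : C, gamma \is Num.real &
  forall p, dotv p p = 0 ->
    gamma / (degree (f ord0))%:R * dotv p (edge_sum (f ord0)) ^+ 2 =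
    dotv (p *m edge_form (f ord0)) p.
Proof.
move=> ff n0; set x := f ord0; have xv : vertex x := flag_vertex ff.
have [la inv] := orthoscheme_invariants (n := n.+1) (b := edge f)
  (fun i j _ _ => edge_orth ff)
  (fun i (i_n : (i < n.+1)%N) =>
     etrans (congr1 negb (dotv_eq0 (edge_real f i))) (edge_neq0 ff i_n))
  n0 (edge_form_sym x) (fun i => edge_mirror ff).
move: inv; rewrite sum_edges //; set mu := _ / _ / _; set nu := _ / _ => inv.
have ur y : adjv x y -> realv (pos y - pos x).
  by case/and4P => _ yv _ _; apply: realvB; apply: pos_real.
have er := edge_real f.
have mur : mu \is Num.real.
  do 2![apply: rpredM; last by rewrite rpredV realv_dotv].
  rewrite dotv_edge_form; apply: rpred_sum => y /ur yr.
  by rewrite rpredM ?realv_dotv.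
have nur : nu \is Num.real.
  rewrite rpredM ?rpredV ?realv_dotv // => i; rewrite summxE.
  by apply: rpred_sum => y /ur.
have nu0 : nu != 0.
  have := dotv_edge_sum_neq0 ff n0; have [-> _] := inv (pos x - center f n.+1).
  by apply: contraNneq => ->; rewrite mul0r.
have deg0 : (degree x)%:R != 0 :> C.
  rewrite pnatr_eq0 -lt0n; have [y xy] := has_neighbour ff n0.
  by apply/card_gt0P; exists y; rewrite inE.
(* The degree cancels the denominator built into [equation1]. *)
exists ((degree x)%:R * (mu / nu ^+ 2)).
  by rewrite rpredM ?rpred_nat // rpredM // rpredV rpredX.
move=> p p0; have [-> ->] := inv p; rewrite p0.
by field; rewrite nu0 deg0.
Qed.

End Polytope.

(** * From the base vertex to every vertex *)

Theorem theorem4p4 (C : numClosedFieldType) (N : nat) (hN : (2 <= N)%N)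
  (P : polytope C N) (hP : regular_polytope P)
  (e1 e2 : 'rV[C]_N) (he : orthonormal_pair e1 e2) :
  exists gamma : C, gamma \is Num.real /\
    forall x : face P, vertex x ->
      equation1 (fun v => orth_proj e1 e2 (pos v)) gamma x.
Proof.
case: N hN P hP e1 e2 he => [|n] // n0 P hP e1 e2 [_ _ e11 e22 e12].
have [[_ _ [[f ff] _] _ _] _ _] := hP.
have [gamma gr H] := isotropic_edge_form hP ff n0.
exists gamma; split=> // x xv; pose p := e1 + 'i *: e2.
have projE v : orth_proj e1 e2 v = dotv p v by rewrite dotvDl dotvZl.
have pp : dotv p p = 0.
  rewrite !(dotvDl, dotvDr, dotvZl, dotvZr) (dotvC e2) e11 e22 e12.
  by rewrite !mulr0 addr0 add0r mulr1 -expr2 sqrCi subrr.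
have xtop : x \in vertices f n.+1 by rewrite inE xv ltnn.
have [g [gf <- _]] := flag_through hP ff xtop.
have [s [Q [t [sQt sg]]]] := flag_transitive hP ff gf.
have x0v := flag_vertex ff; rewrite -sg /equation1.
have -> : \sum_(y | adjv (s (f ord0)) y)
    (orth_proj e1 e2 (pos y) - orth_proj e1 e2 (pos (s (f ord0)))) =
    dotv p (edge_sum (s (f ord0))).
  by rewrite dotv_sumr; apply: eq_bigr => y _; rewrite !projE dotvBr.
have -> : \sum_(y | adjv (s (f ord0)) y)
    (orth_proj e1 e2 (pos (s (f ord0))) - orth_proj e1 e2 (pos y)) ^+ 2 =
    dotv (p *m edge_form (s (f ord0))) p.
  rewrite dotv_edge_form; apply: eq_bigr => y _.
  by rewrite !projE -sqrrN opprB -dotvBr.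
rewrite (symmetry_degree sQt) (symmetry_edge_sum sQt) // (symmetry_edge_form sQt) //.
(* Moving [Q] onto [p] turns the equation at [x] into the one at the base vertex for [p *m Q^T],
   again isotropic; hence one [gamma] serves all vertices. *)
rewrite dotv_mulr; set S := edge_form (f ord0).
have -> : dotv (p *m (Q^T *m S *m Q)) p = dotv (p *m Q^T *m S) (p *m Q^T).
  by rewrite !mulmxA dotvC dotv_mulr dotvC.
apply: H.
by rewrite -dotv_mulr -mulmxA (mulmx1C (symmetry_orth sQt)) mulmx1.
Qed.
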